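(* Let $\mathfrak{g}$ be a finite dimensional simple complex Lie algebra, let $\alpha$ be a simple root and $k$ its coefficient in the decomposition of the maximal root $\alpha_{\max}$ as a combination of simple roots. Let $a(u)=\frac{1}{(1-u)^2}$. (i) If $k=1$, there exists a one-to-one correspondence between Lagrangian subalgebras $W$ of $\mathfrak{g}((u))$, with respect to $Q_{a(u)}$, which are transversal to $\mathfrak{g}[[u]]$ and satisfy $W\subseteq \mathbb{O}_{\alpha}\cap\mathfrak{g}[u,u^{-1}]$, and Lagrangian subalgebras in $\mathfrak{g}[\varepsilon]$, with respect to $\bar{Q}_{\varepsilon}$, transversal to $P_{\alpha}^{-}+\varepsilon (P_{\alpha}^{-})^{\perp}$. (ii) If $k>1$, then there are no Lagrangian subalgebras $W$ of $\mathfrak{g}((u))$, with respect to $Q_{a(u)}$, which are transversal to $\mathfrak{g}[[u]]$ and satisfy $W\subseteq \mathbb{O}_{\alpha}\cap\mathfrak{g}[u,u^{-1}]$.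
   Context: $\mathfrak{g}$ has a fixed Cartan subalgebra $\mathfrak{h}$, root system $R$, set of simple roots $\Gamma=\{\alpha_i\}$, root spaces $\mathfrak{g}_\beta$, and maximal root $\alpha_{\max}=\sum_j k_j\alpha_j$. A root ''contains'' $\alpha$ if its coefficient at $\alpha$ in the expansion in simple roots is non-zero. $K$ denotes the Killing form of $\mathfrak{g}$, and also its $\mathbb{C}((u))$-bilinear extension to $\mathfrak{g}((u))$. The form on $\mathfrak{g}((u))$: $Q_{a(u)}(f_1,f_2)=\mathrm{Res}_{u=0}(a(u)K(f_1(u),f_2(u)))$, where $a(u)$ is regarded as a Taylor series at $u=0$. The maximal order $\mathbb{O}_\alpha$: let $\mathfrak{h}(\mathbb{R})=\{h\in\mathfrak{h}:\beta(h)\in\mathbb{R}\ \forall\beta\in R\}$, and let $v$ be the valuation on $\mathbb{C}((u^{-1}))$ with $v(\sum_{m\ge n}a_mu^{-m})=n$ when $a_n\ne0$ (and $v(0)=+\infty$). For $h\in\mathfrak{h}(\mathbb{R})$ and $\beta\in R$ put $M_\beta(h)=\{f\in\mathbb{C}((u^{-1})):v(f)\ge\beta(h)\}$ and $\mathbb{O}_h=\mathfrak{h}[[u^{-1}]]\oplus\bigoplus_{\beta\in R}M_\beta(h)\otimes\mathfrak{g}_\beta$. For $\alpha=\alpha_j$ set $\mathbb{O}_\alpha=\mathbb{O}_{h_j}$, where $h_j\in\mathfrak{h}(\mathbb{R})$ is defined by $\alpha_i(h_j)=\delta_{ij}/k_j$ for all $i$. The intersection $\mathbb{O}_\alpha\cap\mathfrak{g}[u,u^{-1}]$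 is taken in $\mathfrak{g}((u^{-1}))$, and $\mathfrak{g}[u,u^{-1}]$ is also viewed inside $\mathfrak{g}((u))$. $\mathfrak{g}[\varepsilon]=\mathfrak{g}+\varepsilon\mathfrak{g}$ with $\varepsilon^2=0$, equipped with the form $\bar{Q}_{\varepsilon}(x_1+\varepsilon x_2,y_1+\varepsilon y_2)=K(x_1,y_2)+K(x_2,y_1)$. $P_\alpha^-$ is the standard parabolic subalgebra of $\mathfrak{g}$ spanned by $\mathfrak{h}$, the root spaces of all negative roots and the root spaces of all positive roots which do not contain $\alpha$. $(P_\alpha^-)^\perp$ is its orthogonal complement in $\mathfrak{g}$ with respect to $K$. A Lie subalgebra $W$ is Lagrangian with respect to a nondegenerate invariant bilinear form if $W=W^\perp$. Two subspaces are transversal if the ambient space is their direct sum. *)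

(* Defs.v *)
From HB Require Import structures.
From mathcomp Require Import all_boot all_order all_algebra.
From mathcomp Require Import all_classical reals constructive_ereal.
From mathcomp Require Import complex.
From mathcomp Require Import ring zify.

Set Implicit Arguments.
Unset Strict Implicit.
Unset Printing Implicit Defensive.

Import Order.TTheory GRing.Theory Num.Theory.

Local Open Scope classical_set_scope.
Local Open Scope ring_scope.
Local Open Scope complex_scope.

HB.mixin Record Vector_isLie (K : fieldType) (g : Type) of Vector K g := {
  lie : g -> g -> g;
  lie_linearl : forall (c : K) (x y z : g),
    lie (c *: x + y) z = c *: lie x z + lie y z;
  lie_linearr : forall (c : K) (x y z : g),
    lie z (c *: x + y) = c *: lie z x + lie z y;
  lie_alternating : forall x : g, lie x x = 0;
  lie_jacobi : forall x y z : g,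
    lie x (lie y z) + lie y (lie z x) + lie z (lie x y) = 0
}.

#[short(type="lieAlgType")]
HB.structure Definition LieAlgebra (K : fieldType) :=
  {g of Vector_isLie K g & Vector K g}.

(* The notions of this section are used for infinite dimensional spaces,      *)
(* hence the use of classical sets instead of {vspace _}. The set A is the    *)
(* ambient space.                                                             *)
Section Subspaces.
Variables (K : fieldType) (V : lmodType K).
Implicit Types (A S W : set V) (br : V -> V -> V) (Q : V -> V -> K).

Definition is_subspace W : Prop :=
  W 0 /\ forall (c : K) x y, W x -> W y -> W (c *: x + y).

Definition is_subalgebra br W : Prop :=
  is_subspace W /\ forall x y, W x -> W y -> W (br x y).

Definition linear_span S : set V :=
  [set v | exists (n : nat) (c : 'I_n -> K) (s : 'I_n -> V),
     (forall i, S (s i)) /\ v = \sum_i c i *: s i].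

Definition orth A Q W : set V :=
  [set x | A x /\ forall y, W y -> Q x y = 0].

Definition lagrangian A br Q W : Prop :=
  is_subalgebra br W /\ W = orth A Q W.

Definition are_transversal A W1 W2 : Prop :=
  W1 `&` W2 = [set 0] /\ A = [set x + y | x in W1 & y in W2].

End Subspaces.

(* A formal series with coefficients in V, infinite in either direction, is   *)
(* the function f : int -> V giving the coefficient f n of u^n. In this way   *)
(* V((u)), V((u^-1)) and V[u, u^-1] are subsets of the same space.            *)
Section Series.
Variables (K : fieldType) (V : lmodType K).
Implicit Types f : int -> V.

Definition laurent_u : set (int -> V) :=
  [set f | exists N : int, forall n : int, n < N -> f n = 0].

Definition laurent_uV : set (int -> V) :=
  [set f | exists N : int, forall n : int, N < n -> f n = 0].

Definition laurent_poly : set (int -> V) := laurent_u `&` laurent_uV.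

Definition taylor_u : set (int -> V) :=
  [set f | forall n : int, n < 0 -> f n = 0].

Definition taylor_uV : set (int -> V) :=
  [set f | forall n : int, 0 < n -> f n = 0].

End Series.

Arguments laurent_u {K} V.
Arguments laurent_uV {K} V.
Arguments laurent_poly {K} V.
Arguments taylor_u {K} V.
Arguments taylor_uV {K} V.

(* Extension of a bilinear map to Laurent series. On laurent_u the sum has    *)
(* finite support.                                                            *)
Definition convolve (U V W : nmodType) (op : U -> V -> W)
    (f1 : int -> U) (f2 : int -> V) : int -> W :=
  fun n => \sum_(i \in [set: int]) op (f1 i) (f2 (n - i)).

Definition residue (K : nmodType) (f : int -> K) : K := f (-1).

(* The Taylor series of 1 / (1 - u)^2 at u = 0, see taylor_inv_sqrP below.    *)
Definition taylor_inv_sqr (K : pzRingType) : int -> K :=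
  fun n => if n is Posz m then m.+1%:R else 0.

Lemma taylor_inv_sqrP (K : fieldType) :
  convolve *%R
    (fun n : int => (n == 0)%:R - (n == 1)%:R *+ 2 + (n == 2)%:R : K)
    (taylor_inv_sqr K)
  = (fun n : int => (n == 0)%:R).
Proof.
apply/funext => n; rewrite /convolve.
rewrite (fsbigE [:: 0; 1; 2]) //=; last first.
  move=> i _; rewrite !inE !negb_or => /and3P[/negPf-> /negPf-> /negPf->].
  by rewrite mul0rn subr0 addr0 mul0r.
rewrite !big_cons big_nil /= !in_setT subr0.
rewrite /= !(mulr0n, mulr1n, mul0rn, mul0r, add0r, addr0, subr0, mul1r).
rewrite mulNr oppr0 add0r mul1r.
case: n => [[|[|n]]|n].
- by rewrite /= mulr0 oppr0 !addr0.
- by rewrite /= mulr1 addr0 subrr.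
- have -> : n.+2%:Z - 1 = n.+1%:Z by rewrite -addn1 PoszD addrK.
  have -> : n.+2%:Z - 2 = n%:Z by rewrite -addn2 PoszD addrK.
  rewrite /= -[n.+3]addn2 -[n.+2]addn1 -[n.+1]addn1 !natrD.
  by ring.
- have -> : Negz n - 1 = Negz n.+1 by rewrite !NegzE; lia.
  have -> : Negz n - 2 = Negz n.+2 by rewrite !NegzE; lia.
  by rewrite /= mulr0 oppr0 !addr0.
Qed.

Section LieAlgebraNotions.
Variables (K : fieldType) (g : lieAlgType K).

Definition is_ideal (I : {vspace g}) : Prop :=
  forall x y : g, y \in I -> lie x y \in I.

Definition is_simple : Prop :=
  (exists x y : g, lie x y != 0) /\
  forall I : {vspace g}, is_ideal I -> I = 0%VS \/ I = fullv.

Definition killing (x y : g) : K :=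
  \tr (passmx.mxof (vbasis fullv) (vbasis fullv)
         (linfun (fun z => lie x (lie y z)))).

Definition ad_diagonalizable (x : g) : Prop :=
  exists e : (\dim {:g}).-tuple g, basis_of fullv e /\
    forall i, exists c : K, lie x (tnth e i) = c *: tnth e i.

(* Cartan subalgebras of a complex semisimple Lie algebra, as in B. C. Hall,  *)
(* Lie Groups, Lie Algebras, and Representations.                             *)
Definition is_cartan (H : {vspace g}) : Prop :=
  [/\ forall x y, x \in H -> y \in H -> lie x y = 0,
      forall x, (forall h, h \in H -> lie h x = 0) -> x \in H
    & forall h, h \in H -> ad_diagonalizable h].

Definition lie_series : (int -> g) -> (int -> g) -> int -> g :=
  convolve (@lie K g).

Definition killing_series : (int -> g) -> (int -> g) -> int -> K :=
  convolve killing.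

Definition form_series (a : int -> K) (f1 f2 : int -> g) : K :=
  residue (convolve *%R a (killing_series f1 f2)).

(* The pair (x1, x2) stands for x1 + eps x2 with eps^2 = 0.                   *)
Definition lie_eps (x y : g * g) : g * g :=
  (lie x.1 y.1, lie x.1 y.2 + lie x.2 y.1).

Definition form_eps (x y : g * g) : K := killing x.1 y.2 + killing x.2 y.1.

End LieAlgebraNotions.

Section Roots.
Variables (K : numFieldType) (g : lieAlgType K) (H : {vspace g}).

Definition cartan_dual := 'Hom(subvs_of H, K^o).

Definition root_space (b : cartan_dual) : set g :=
  [set x | forall h : subvs_of H, lie (vsval h) x = (b h : K) *: x].

Definition is_root (b : cartan_dual) : Prop :=
  b != 0 /\ exists x, root_space b x /\ x != 0.

Definition is_simple_roots (l : nat) (G : l.-tuple cartan_dual) : Prop :=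
  [/\ forall i, is_root (tnth G i),
      basis_of fullv G
    & forall b, is_root b -> exists n : 'I_l -> nat,
        b = \sum_i tnth G i *+ n i \/ b = - \sum_i tnth G i *+ n i].

Variables (l : nat) (G : l.-tuple cartan_dual).

Definition root_coef (i : 'I_l) (b : cartan_dual) : K := coord G i b.

Definition is_positive_root (b : cartan_dual) : Prop :=
  is_root b /\ forall i, 0 <= root_coef i b.

Definition is_negative_root (b : cartan_dual) : Prop :=
  is_root b /\ forall i, root_coef i b <= 0.

Definition is_maximal_root (amax : cartan_dual) : Prop :=
  is_root amax /\ forall b, is_root b -> exists n : 'I_l -> nat,
    amax = b + \sum_i tnth G i *+ n i.

Definition contains_simple_root (j : 'I_l) (b : cartan_dual) : Prop :=
  root_coef j b != 0.

Definition parabolic (j : 'I_l) : set g :=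
  linear_span ([set x | x \in H]
    `|` \bigcup_(b in [set b | is_negative_root b]) root_space b
    `|` \bigcup_(b in [set b | is_positive_root b /\ ~ contains_simple_root j b])
          root_space b).

Definition parabolic_eps (j : 'I_l) : set (g * g) :=
  parabolic j `*` orth setT (@killing K g) (parabolic j).

Definition real_cartan : set (subvs_of H) :=
  [set h | forall b, is_root b -> (b h : K) \is Num.real].

Definition is_vertex (amax : cartan_dual) (j : 'I_l) (h : subvs_of H) : Prop :=
  real_cartan h /\
  forall i, (tnth G i h : K) = (i == j)%:R / root_coef j amax.

End Roots.

Section Order.
Variables (R : realType) (g : lieAlgType R[i]) (H : {vspace g}).

Definition is_leading (f : int -> R[i]) (n : int) : Prop :=
  f (- n) != 0 /\ forall m : int, m < n -> f (- m) = 0.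

(* The valuation of C((u^-1)).                                                *)
Definition valuation (f : int -> R[i]) : \bar R :=
  if `[< f = 0 >] then +oo%E else ((xget 0 [set n | is_leading f n])%:~R)%:E.

(* Only used for h in real_cartan, where b h is equal to its real part.       *)
Definition valuation_module (b : cartan_dual H) (h : subvs_of H) :
    set (int -> R[i]) :=
  [set f | laurent_uV (R[i]^o) f /\ ((complex.Re (b h))%:E <= valuation f)%E].

Definition order_of (h : subvs_of H) : set (int -> g) :=
  linear_span ([set f | taylor_uV g f /\ forall n, f n \in H]
    `|` \bigcup_(b in [set b | is_root b])
          [set (fun n => m n *: x) | m in valuation_module b h
                                   & x in root_space b]).

End Order.

(* Main.v *)
Require Import Defs.
From HB Require Import structures.
From mathcomp Require Import all_boot all_order all_algebra.
From mathcomp Require Import all_classical reals constructive_ereal.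
From mathcomp Require Import complex.
From mathcomp Require Import ring lra zify.

Set Implicit Arguments.
Unset Strict Implicit.
Unset Printing Implicit Defensive.

Import Order.TTheory GRing.Theory Num.Theory.
Import passmx.

Local Open Scope classical_set_scope.
Local Open Scope ring_scope.
Local Open Scope complex_scope.

(** Write T for the adjoint action of the vertex h_j, and let F_r be the sum of
    the eigenspaces of T whose eigenvalues have real part at most r.  A Laurent
    polynomial f lies in the order attached to h_j exactly when its coefficient
    at u^m lies in F_(-m) for every m; write A for the space of these f.  The
    subspaces F_r are multiplicative for the bracket, F_r and F_s are orthogonal
    for the Killing form when r + s < 0, and, the form being nondegenerate, the
    annihilator of everything of degree less than -r is contained in F_r.  Apart
    from one root vector in the case k > 1, roots serve only to produce a basis
    of eigenvectors of T, to bound the eigenvalues, and to identify A and the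
    parabolic subalgebra.

    Suppose k = 1.  The eigenvalues of T are then -1, 0 and 1: they are of the
    form 1 - m by maximality of the highest root, and an eigenvalue at most -2
    would have an eigenvector orthogonal to everything.  For f in A the series
    Ad(u^h) f is a polynomial in t = 1/u, and taking its value and its first
    derivative at t = 1 defines a map theta from A to g[eps].  It is a
    surjective homomorphism of Lie algebras, and it carries the residue form to
    the form of g[eps], because the residue at 0 of F(t) / (1 - u)^2 is F'(1)
    for a polynomial F.  It maps the Taylor series of A bijectively onto
    F_0 x F_(-1), that is onto the sum of the parabolic subalgebra and of eps
    times its orthogonal complement ([eval_eps_taylor_image]).  Every Lagrangian
    W contained in A is saturated for theta, since an element of the kernel is
    orthogonal to A and hence belongs to W, which is its own orthogonal.
    Conversely, the orthogonal of the kernel of theta is contained in A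
    ([orth_ker_eval_eps]): the kernel contains the products
    (1 - 1/u)^2 u^m x, and pairing f with them reads off the coefficients of f.
    So W and its image under theta determine each other ([series_eps_bij]).

    Suppose k > 1 and let x be a root vector for the simple root, so that
    T x = x / k.  The element f = (1 - 1/u)^2 x pairs with w as the coefficient
    of w at u pairs with x; if w lies in the order, that coefficient lies in
    F_(-1), and it is orthogonal to x because 1/k - 1 < 0.  Hence f belongs to
    every Lagrangian contained in the order; but its constant coefficient x has
    positive degree, which the order forbids.

    The kernel of the Killing form is an ideal of a simple algebra, so the form
    is either nondegenerate or zero.  If it were zero, a Lagrangian would be the
    whole ambient space and could not be transversal to anything nonzero; this
    alternative is thus settled without Cartan's criterion. *)

(** * Lie brackets and the Killing form *)

Section Killing.
Variables (K : fieldType) (g : lieAlgType K).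
Implicit Types (x y z : g) (h : g) (c d : K).

Lemma lie_is_bilinear : bilinear_for *:%R *:%R (@lie K g).
Proof. by split=> z c x y; [exact: lie_linearl|exact: lie_linearr]. Qed.

HB.instance Definition _ := @bilinear_isBilinear.Build K g g g *:%R *:%R
  (@lie K g) lie_is_bilinear.

Lemma lieDl x y z : lie (x + y) z = lie x z + lie y z.
Proof. exact: linearDl. Qed.
Lemma lieDr x y z : lie z (x + y) = lie z x + lie z y.
Proof. exact: linearDr. Qed.
Lemma lieZl c x y : lie (c *: x) y = c *: lie x y.
Proof. exact: linearZl_LR. Qed.
Lemma lieZr c x y : lie x (c *: y) = c *: lie x y.
Proof. exact: linearZr_LR. Qed.
Lemma lie0l x : lie 0 x = 0. Proof. exact: linear0l. Qed.
Lemma lie0r x : lie x 0 = 0. Proof. exact: linear0r. Qed.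
Lemma lieNl x y : lie (- x) y = - lie x y. Proof. exact: linearNl. Qed.
Lemma lieNr x y : lie x (- y) = - lie x y. Proof. exact: linearNr. Qed.
Lemma lie_suml I (r : seq I) (P : pred I) (E : I -> g) x :
  lie (\sum_(i <- r | P i) E i) x = \sum_(i <- r | P i) lie (E i) x.
Proof. exact: linear_sumlz. Qed.
Lemma lie_sumr I (r : seq I) (P : pred I) (E : I -> g) x :
  lie x (\sum_(i <- r | P i) E i) = \sum_(i <- r | P i) lie x (E i).
Proof. exact: linear_sumr. Qed.

Lemma lie_anti x y : lie x y = - lie y x.
Proof.
apply/eqP; rewrite -addr_eq0; apply/eqP.
have := lie_alternating (x + y).
by rewrite lieDl !lieDr !lie_alternating add0r addr0.
Qed.

Lemma lie_leibniz x y z : lie x (lie y z) = lie (lie x y) z + lie y (lie x z).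
Proof.
rewrite (lie_anti (lie x y)) (lie_anti x z) lieNr -opprD.
apply/eqP; rewrite -addr_eq0 [lie z _ + _]addrC addrA; apply/eqP.
exact: lie_jacobi.
Qed.

HB.instance Definition _ x := GRing.isLinear.Build K g g *:%R (lie x)
  (fun c y z => lie_linearr c y z x).

Let ad2 x y : 'End(g) := linfun (lie x \o lie y).

Let ad2E x y z : ad2 x y z = lie x (lie y z).
Proof. by rewrite lfunE. Qed.

Let tr_ad2 x y :
  killing x y = \tr (mxof (vbasis {:g}) (vbasis {:g}) (ad2 x y)).
Proof. by []. Qed.

Lemma killing_is_bilinear : bilinear_for *%R *%R (@killing K g).
Proof.
split=> z c x y /=; rewrite !tr_ad2 -mxtraceZ -mxtraceD -mxof_linear;
  congr (\tr (mxof _ _ _)); apply/lfunP => v;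
  rewrite add_lfunE scale_lfunE !ad2E.
  by rewrite lieDl lieZl.
by rewrite lieDl lieZl lieDr lieZr.
Qed.

HB.instance Definition _ := @bilinear_isBilinear.Build K g g K *%R *%R
  (@killing K g) killing_is_bilinear.

Lemma killingDl x y z : killing (x + y) z = killing x z + killing y z.
Proof. exact: linearDl. Qed.
Lemma killingDr x y z : killing z (x + y) = killing z x + killing z y.
Proof. exact: linearDr. Qed.
Lemma killingZl c x y : killing (c *: x) y = c * killing x y.
Proof. exact: linearZl_LR. Qed.
Lemma killingZr c x y : killing x (c *: y) = c * killing x y.
Proof. exact: linearZr_LR. Qed.
Lemma killing0l x : killing 0 x = 0. Proof. exact: linear0l. Qed.
Lemma killingNl x y : killing (- x) y = - killing x y.
Proof. exact: linearNl. Qed.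
Lemma killingNr x y : killing x (- y) = - killing x y.
Proof. exact: linearNr. Qed.
Lemma killingMnl x y m : killing (x *+ m) y = killing x y *+ m.
Proof. exact: linearMnl. Qed.
Lemma killing_suml I (r : seq I) (P : pred I) (E : I -> g) x :
  killing (\sum_(i <- r | P i) E i) x = \sum_(i <- r | P i) killing (E i) x.
Proof. exact: linear_sumlz. Qed.
Lemma killing_sumr I (r : seq I) (P : pred I) (E : I -> g) x :
  killing x (\sum_(i <- r | P i) E i) = \sum_(i <- r | P i) killing x (E i).
Proof. exact: linear_sumr. Qed.

HB.instance Definition _ x := GRing.isLinear.Build K g K^o *:%R (killing x)
  (fun c y z => linearPr (@killing K g) x c y z).

Let ad x := mxof (vbasis {:g}) (vbasis {:g}) (linfun (lie x)).

Let killingE x y : killing x y = \tr (ad y *m ad x).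
Proof.
rewrite tr_ad2 /ad -mxof_comp ?vbasisP //.
congr (\tr (mxof _ _ _)).
by apply/lfunP => v; rewrite ad2E comp_lfunE !lfunE.
Qed.

Let ad_lie x y : ad (lie x y) = ad y *m ad x - ad x *m ad y.
Proof.
rewrite /ad -!mxof_comp ?vbasisP //.
rewrite addrC -scaleN1r -mxof_linear.
congr (mxof _ _ _); apply/lfunP => v.
rewrite add_lfunE scale_lfunE !comp_lfunE !lfunE /= scaleN1r addrC.
by rewrite (lie_leibniz x y v) addrK.
Qed.

Lemma killingC x y : killing x y = killing y x.
Proof. by rewrite !killingE mxtrace_mulC. Qed.

Lemma killing_inv x y z : killing (lie x y) z = killing x (lie y z).
Proof.
rewrite !killingE !ad_lie mulmxBr mulmxBl !linearB /=.
by rewrite -mulmxA; congr (_ - _); rewrite mulmxA mxtrace_mulC mulmxA.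
Qed.

Lemma killing_skew h x y : killing (lie h x) y = - killing x (lie h y).
Proof. by rewrite lie_anti killingNl killing_inv. Qed.

Definition killing_nondeg := forall x, (forall y, killing x y = 0) -> x = 0.

(** By invariance the kernel of the Killing form is an ideal. *)
Lemma simple_killing :
  is_simple g -> killing_nondeg \/ forall x y, killing x y = 0.
Proof.
move=> [_ simp].
pose kf i : 'Hom(g, K^o) := linfun (killing (vbasis {:g})`_i : g -> K^o).
pose I := (\bigcap_(i < \dim {:g}) lker (kf i))%VS.
have memI x : x \in I <-> forall y, killing x y = 0.
  have kerE i : (x \in lker (kf i)) = (killing x (vbasis {:g})`_i == 0).
    by rewrite memv_ker lfunE /= killingC.
  rewrite memvE; split=> [/subv_bigcapP Ix y|Ix].
    rewrite (coord_vbasis (memvf y)) killing_sumr big1 // => i _.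
    have := Ix i isT; rewrite -memvE kerE => /eqP K0.
    by rewrite killingZr K0 mulr0.
  by apply/subv_bigcapP => i _; rewrite -memvE kerE Ix.
have idI : is_ideal I.
  move=> x y /memI Iy; apply/memI => z.
  by rewrite lie_anti killingNl killing_inv Iy oppr0.
have [I0|If] := simp _ idI; [left|right].
  by move=> x /memI; rewrite I0 memv0 => /eqP.
by move=> x; apply/memI; rewrite If memvf.
Qed.

(** By invariance c + d multiplies [killing x y] to 0. *)
Lemma killing_eigen h c d x y :
  lie h x = c *: x -> lie h y = d *: y -> c + d != 0 -> killing x y = 0.
Proof.
move=> hx hy /negPf cd0.
have : (c + d) * killing x y = 0.
  rewrite mulrDl -killingZl -killingZr -hx -hy.
  by rewrite killing_skew addNr.
by move/eqP; rewrite mulf_eq0 cd0 => /eqP.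
Qed.

Lemma lie_eigen h c d x y :
  lie h x = c *: x -> lie h y = d *: y -> lie h (lie x y) = (c + d) *: lie x y.
Proof. by move=> hx hy; rewrite lie_leibniz hx hy lieZl lieZr scalerDl. Qed.

End Killing.

(** * A basis of joint eigenvectors of a Cartan subalgebra *)

Section Eigenbasis.
Variables (K : numFieldType) (g : lieAlgType K) (H : {vspace g}).
Hypothesis cartanH : is_cartan H.

Let e0 := vbasis {:g}.
Let e0B : basis_of {:g} e0 := vbasisP {:g}.
Let ad (h : g) := mxof e0 e0 (linfun (lie h)).

(** Turns diagonalizability by a basis of vectors into diagonalizability of the
    matrix in one fixed basis, where simultaneous diagonalization applies. *)
Lemma ad_diagonalizable_mx h : ad_diagonalizable h -> diagonalizable (ad h).
Proof.
move=> [f [fB fE]].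
pose P := mxof f e0 \1%VF.
have Pu : P \in unitmx.
  have : P *m mxof e0 f \1%VF = 1%:M.
    by rewrite -mxof_comp // comp_lfun1l mxof1 // (basis_free fB).
  by case/mulmx1_unit.
pose D := mxof f f (linfun (lie h)).
have PD : P *m ad h = D *m P.
  by rewrite -!mxof_comp // comp_lfun1l comp_lfun1r.
exists P => //.
apply/diagonalizable_forPex; exists (\row_i D i i).
apply/(simmxP Pu); rewrite PD; congr (_ *m _).
apply/matrixP => i k; rewrite !mxE /=.
have [->|ik] := eqVneq i k; first by rewrite mulr1n.
rewrite mulr0n vecof_delta lfunE /=.
have [c hc] := fE i; rewrite -tnth_nth hc linearZ /= (tnth_nth 0).
rewrite coord_free ?(basis_free fB) //.
by rewrite (negPf ik) mulr0.
Qed.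

(** The root space decomposition.  The maps [lie h], for h in a basis of H,
    commute and are diagonalizable, hence are diagonal in a common basis. *)
Lemma cartan_eigenbasis :
  exists e : (\dim {:g}).-tuple g, basis_of fullv e /\
    forall i, exists b : cartan_dual H, root_space b (tnth e i).
Proof.
have [Hab _ Hdiag] := cartanH.
have [P Pu /allP Pdiag] : codiagonalizable [seq ad h | h <- vbasis H].
  apply/codiagonalizableP; split=> [_ _ /mapP[x xH ->] /mapP[y yH ->]|].
    rewrite /comm_mx /ad -!mxof_comp //.
    congr (mxof _ _ _); apply/lfunP => v.
    rewrite !comp_lfunE !lfunE /= (lie_leibniz y x v).
    by rewrite (Hab y x) ?lie0l ?add0r //; exact: vbasis_mem.
  move=> _ /mapP[x xH ->]; apply: ad_diagonalizable_mx.
  by apply: Hdiag; apply: vbasis_mem.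
pose e := [tuple vecof e0 (row i P) | i < \dim {:g}].
have eE i : tnth e i = vecof e0 (row i P) by rewrite tnth_mktuple.
have efree : free e.
  apply/freeP => k; have -> : \sum_i k i *: e`_i = vecof e0 ((\row_i k i) *m P).
    rewrite mulmx_sum_row linear_sum; apply: eq_bigr => i _.
    by rewrite -tnth_nth eE mxE linearZ.
  move/eqP; rewrite vecof_eq0 // => /eqP kP i.
  have : \row_i k i = 0 :> 'rV_(\dim {:g}).
    by apply: (can_inj (mulmxK Pu)); rewrite kP mul0mx.
  by move/rowP/(_ i); rewrite !mxE.
have eB : basis_of fullv e.
  by rewrite basisEfree efree subvf size_tuple leqnn.
exists e; split=> // i.
have eig h : h \in H -> exists c, lie h (tnth e i) = c *: tnth e i.
  move=> hH; have eig1 (k : 'I_(\dim H)) :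
      exists c, lie (vbasis H)`_k (tnth e i) = c *: tnth e i.
    have kH : (vbasis H)`_k \in vbasis H by rewrite mem_nth ?size_tuple.
    have /diagonalizable_forPex[d /(simmxP Pu) Pd] := Pdiag _ (map_f ad kH).
    exists (d 0 i); rewrite eE.
    have -> x : lie (vbasis H)`_k x = (linfun (lie (vbasis H)`_k)) x by rewrite lfunE.
    rewrite (hom_vecof _ e0B) -row_mul Pd row_mul row_diag_mx.
    by rewrite -scalemxAl -rowE linearZ.
  have [c cE] := choice eig1.
  exists (\sum_k coord (vbasis H) k h * c k).
  rewrite {1}(coord_vbasis hH) lie_suml scaler_suml; apply: eq_bigr => k _.
  by rewrite lieZl cE scalerA.
(* The weight of the i-th vector is h |-> i-th coordinate of [h, e_i]; the two
   signs put h in the linear argument of the bracket. *)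
pose b : cartan_dual H :=
  linfun ((coord e i : g -> K^o) \o lie (- tnth e i) \o vsval).
exists b => h /=; have [c hc] := eig _ (subvsP h).
rewrite /b lfunE /= (lie_anti (- _)) lieNr opprK hc linearZ /=.
by rewrite [in coord _ _ _](tnth_nth 0) coord_free // eqxx mulr1.
Qed.

Lemma root_space0_cartan x : root_space (0 : cartan_dual H) x -> x \in H.
Proof.
have [_ + _] := cartanH; move=> Hmax x0; apply: Hmax => h hH.
have := x0 (Subvs hH); rewrite lfunE /= scale0r.
by move=> <-.
Qed.

End Eigenbasis.

(** * The filtration of a Lie algebra by the eigenvalues of one element *)

Section Filtration.
Variables (R : realType) (g : lieAlgType R[i]).
Local Notation n := (\dim {:g}).
Variables (e : n.-tuple g) (h : g) (d : 'I_n -> R[i]).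
Implicit Types (x y z : g) (r s : R).

(** The sum of the eigenspaces of [lie h] whose eigenvalues have real part at
    most r, described in a basis of eigenvectors [e] with eigenvalues [d]. *)
Definition ad_filt r x := forall i, r < complex.Re (d i) -> coord e i x = 0.

Lemma filt_subspace r : is_subspace (ad_filt r).
Proof.
split=> [i _|c x y fx fy i ri]; first by rewrite linear0.
by rewrite linearP /= fx // fy // mulr0 addr0.
Qed.

Lemma filt_le r s x : r <= s -> ad_filt r x -> ad_filt s x.
Proof. by move=> rs fx i si; apply: fx; apply: le_lt_trans si. Qed.

Hypothesis eB : basis_of fullv e.
Hypothesis he : forall i, lie h (tnth e i) = d i *: tnth e i.

Lemma coord_tnth i k : coord e i (tnth e k) = (k == i)%:R.
Proof. by rewrite (tnth_nth 0) coord_free ?(basis_free eB). Qed.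

Lemma sum_coord x : x = \sum_i coord e i x *: tnth e i.
Proof.
rewrite {1}(coord_basis eB (memvf x)); apply: eq_bigr => i _.
by rewrite (tnth_nth 0).
Qed.

Lemma coord_inj x y : (forall i, coord e i x = coord e i y) -> x = y.
Proof.
move=> xy; rewrite (sum_coord x) (sum_coord y).
by apply: eq_bigr => i _; rewrite xy.
Qed.

Lemma coord_lie i x : coord e i (lie h x) = d i * coord e i x.
Proof.
rewrite {1}(sum_coord x) lie_sumr linear_sum /= (bigD1 i) //= big1 ?addr0.
  by rewrite lieZr he !linearZ /= coord_tnth eqxx mulr1 mulrC.
move=> k ki; rewrite lieZr he !linearZ /= coord_tnth.
by rewrite (negPf ki) !mulr0.
Qed.

Lemma coord_eigen c z i : lie h z = c *: z -> d i != c -> coord e i z = 0.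
Proof.
move=> hz dc; apply/eqP; have : (d i - c) * coord e i z == 0.
  by rewrite mulrBl -coord_lie hz linearZ subrr.
by rewrite mulf_eq0 subr_eq0 (negPf dc).
Qed.

Lemma filt_eigen c z r : lie h z = c *: z -> complex.Re c <= r -> ad_filt r z.
Proof.
move=> hz cr i ri; apply: (coord_eigen hz).
by apply/eqP => dc; move: ri; rewrite dc ltNge cr.
Qed.

Lemma filt_tnth r i : complex.Re (d i) <= r -> ad_filt r (tnth e i).
Proof. by move=> ir; apply: (filt_eigen (he i)). Qed.

Lemma filt_expand r x : ad_filt r x ->
  x = \sum_(i | complex.Re (d i) <= r) coord e i x *: tnth e i.
Proof.
move=> fx; rewrite {1}(sum_coord x).
rewrite (bigID (fun i => complex.Re (d i) <= r)) /= [X in _ + X]big1 ?addr0 //.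
by move=> i; rewrite -ltNge => /fx ->; rewrite scale0r.
Qed.

Lemma filt_eigen_eq0 c z r :
  lie h z = c *: z -> r < complex.Re c -> ad_filt r z -> z = 0.
Proof.
move=> hz rc fz; apply: coord_inj => i; rewrite linear0.
have [dc|dc] := eqVneq (d i) c; last exact: coord_eigen hz dc.
by apply: fz; rewrite dc.
Qed.

Lemma filt_sum r I (s : seq I) (P : pred I) (E : I -> g) :
  (forall i, P i -> ad_filt r (E i)) -> ad_filt r (\sum_(i <- s | P i) E i).
Proof. by move=> fE i ri; rewrite linear_sum big1 //= => k Pk; apply: fE. Qed.

Lemma filtZ r c x : ad_filt r x -> ad_filt r (c *: x).
Proof. by move=> fx i ri; rewrite linearZ /= fx ?mulr0. Qed.

Lemma filt_lie r s x y : ad_filt r x -> ad_filt s y -> ad_filt (r + s) (lie x y).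
Proof.
move=> /filt_expand -> /filt_expand ->; rewrite lie_suml.
apply: filt_sum => i ir; rewrite lie_sumr; apply: filt_sum => k ks.
rewrite lieZl lieZr; do 2 apply: filtZ.
apply: (filt_eigen (lie_eigen (he i) (he k))).
by rewrite raddfD lerD.
Qed.

Lemma filt_killing r s x y :
  ad_filt r x -> ad_filt s y -> r + s < 0 -> killing x y = 0.
Proof.
move=> /filt_expand -> /filt_expand -> rs; rewrite killing_suml.
rewrite big1 // => i ir; rewrite killing_sumr big1 // => k ks.
rewrite killingZl killingZr (killing_eigen (he i) (he k)) ?mulr0 //.
apply/eqP => /(congr1 (@complex.Re R)); rewrite raddfD /=; lra.
Qed.

(** Duality.  The part of x of degree greater than r is orthogonal to basis
    vectors of degree at least -r for reasons of degree, and to the others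
    because both x and the remaining part of x are. *)
Lemma filt_orth r x : killing_nondeg g ->
  (forall i, complex.Re (d i) < - r -> killing x (tnth e i) = 0) -> ad_filt r x.
Proof.
move=> Knd xe.
pose lo := \sum_(i | complex.Re (d i) <= r) coord e i x *: tnth e i.
pose hi := \sum_(i | ~~ (complex.Re (d i) <= r)) coord e i x *: tnth e i.
have xE : x = lo + hi by rewrite {1}(sum_coord x) (bigID (fun i => complex.Re (d i) <= r)).
suff hi0 : hi = 0.
  rewrite xE hi0 addr0; apply: filt_sum => i ir.
  by apply: filtZ; apply: filt_tnth.
apply: Knd => y; rewrite (sum_coord y) killing_sumr big1 // => k _.
rewrite killingZr; suff -> : killing hi (tnth e k) = 0 by rewrite mulr0.
have [kr|rk] := ltP (complex.Re (d k)) (- r).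
  have -> : hi = x - lo by rewrite xE addrC addKr.
  rewrite killingDl killingNl xe // sub0r killing_suml big1 ?oppr0 // => i ir.
  rewrite killingZl (killing_eigen (he i) (he k)) ?mulr0 //.
  by apply/eqP => /(congr1 (@complex.Re R)); rewrite raddfD /=; lra.
rewrite killing_suml big1 // => i; rewrite -ltNge => ir.
rewrite killingZl (killing_eigen (he i) (he k)) ?mulr0 //.
by apply/eqP => /(congr1 (@complex.Re R)); rewrite raddfD /=; lra.
Qed.

Section Minuscule.
Hypothesis d3 : forall i, [\/ d i = -1, d i = 0 | d i = 1].

Let Re1 : complex.Re (1 : R[i]) = 1. Proof. by []. Qed.
Let ReN1 : complex.Re (-1 : R[i]) = -1. Proof. by []. Qed.
Let Re0 : complex.Re (0 : R[i]) = 0. Proof. by []. Qed.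

Lemma filt1 r x : 1 <= r -> ad_filt r x.
Proof.
move=> r1 i; case: (d3 i) => ->; rewrite ?Re1 ?ReN1 ?Re0 => ri; exfalso; lra.
Qed.

Lemma filt_ltN1 r x : r < -1 -> ad_filt r x -> x = 0.
Proof.
move=> r1 fx; apply: coord_inj => i; rewrite linear0; apply: fx.
case: (d3 i) => ->; rewrite ?Re1 ?ReN1 ?Re0; lra.
Qed.

Lemma filtN1_lie x : ad_filt (-1) x -> lie h x = - x.
Proof.
move=> fx; apply: coord_inj => i; rewrite coord_lie linearN /=.
case: (d3 i) => di; first by rewrite di mulN1r.
  by rewrite fx ?mulr0 ?oppr0 // di Re0; lra.
by rewrite fx ?mulr0 ?oppr0 // di Re1; lra.
Qed.

Lemma filt0_lie x : ad_filt 0 x -> ad_filt (-1) (lie h x).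
Proof.
move=> fx i; rewrite coord_lie; case: (d3 i) => di; rewrite di.
- by rewrite ReN1 ltxx.
- by rewrite mul0r.
- by rewrite Re1 => _; rewrite fx ?mulr0 // di Re1; lra.
Qed.

End Minuscule.
End Filtration.

(** * Sums and convolutions of two-sided sequences *)

Section IntSum.
Implicit Types (U V W : zmodType).

Definition supported V (N : nat) (f : int -> V) :=
  forall n : int, ~~ (- N%:Z <= n < N%:Z) -> f n = 0.

Definition finitely_supported V (f : int -> V) := exists N, supported N f.

Lemma supported_le V N M (f : int -> V) :
  (N <= M)%N -> supported N f -> supported M f.
Proof. by move=> NM fN n nM; apply: fN; lia. Qed.

(** Sums over the integers are only meaningful for finite supports; a common
    window for all the sequences at hand reduces them to ordinary big sums. *)
Lemma intsum_box V N (f : int -> V) : supported N f ->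
  \sum_(i \in [set: int]) f i = \sum_(k < N + N) f (k%:Z - N%:Z).
Proof.
move=> fN; rewrite (fsbigE [seq k%:Z - N%:Z | k <- iota 0 (N + N)]) //=.
- have -> : iota 0 (N + N) = index_iota 0 (N + N) by rewrite /index_iota subn0.
  rewrite big_mkcond /= big_map big_mkord.
  by apply: eq_bigr => k _; rewrite in_setT.
- by rewrite map_inj_uniq ?iota_uniq // => a b; lia.
- move=> i _ iN; apply: fN; apply: contra iN => iN.
  apply/mapP; exists (absz (i + N%:Z)%R); last by lia.
  by rewrite mem_iota; lia.
Qed.

Lemma intsum_seq V (r : seq int) (f : int -> V) :
  uniq r -> (forall m, m \notin r -> f m = 0) ->
  \sum_(m \in [set: int]) f m = \sum_(m <- r) f m.
Proof.
move=> ru rf; rewrite (fsbigE r) // => [|i _]; last exact: rf.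
by apply: eq_bigl => m; rewrite in_setT.
Qed.

Lemma intsumD V (f g : int -> V) :
  finitely_supported f -> finitely_supported g ->
  \sum_(i \in [set: int]) (f i + g i) =
  \sum_(i \in [set: int]) f i + \sum_(i \in [set: int]) g i.
Proof.
move=> [N fN] [M gM].
have fS : supported (N + M) f by apply: supported_le fN; lia.
have gS : supported (N + M) g by apply: supported_le gM; lia.
rewrite (intsum_box fS) (intsum_box gS) -big_split /=.
by rewrite (@intsum_box _ (N + M)) // => n nS; rewrite fS // gS // addr0.
Qed.

Lemma intsum_raddf V W (phi : {additive V -> W}) (f : int -> V) :
  finitely_supported f ->
  \sum_(i \in [set: int]) phi (f i) = phi (\sum_(i \in [set: int]) f i).
Proof.
move=> [N fN]; rewrite (intsum_box fN) (@intsum_box _ N) ?raddf_sum //.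
by move=> n /fN ->; rewrite raddf0.
Qed.

Lemma intsum_shift V (f : int -> V) (m : int) :
  \sum_(i \in [set: int]) f (i - m) = \sum_(i \in [set: int]) f i.
Proof.
by symmetry; apply: reindex_fsbigT; exists (fun i => i + m) => i; lia.
Qed.

Lemma intsum_refl V (f : int -> V) (m : int) :
  \sum_(i \in [set: int]) f (m - i) = \sum_(i \in [set: int]) f i.
Proof.
by symmetry; apply: reindex_fsbigT; exists (fun i => m - i) => i; lia.
Qed.

(** The Euler derivation u d/du. *)
Definition euler V (f : int -> V) (n : int) := f n *~ n.

Lemma supported_euler V N (f : int -> V) :
  supported N f -> supported N (euler f).
Proof. by move=> fN n /fN fn0; rewrite /euler fn0 mul0rz. Qed.

End IntSum.

Section Convolution.
Variables (K : fieldType) (U V : lmodType K) (W : zmodType).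
Variables (s s' : K -> W -> W) (op : {bilinear U -> V -> W | s & s'}).
Implicit Types (f : int -> U) (g : int -> V).

Lemma bilinearMzl x y m : op (x *~ m) y = op x y *~ m.
Proof. by rewrite -!(applyrE op) raddfMz. Qed.

Lemma bilinearMzr x y m : op x (y *~ m) = op x y *~ m.
Proof. by rewrite raddfMz. Qed.

Lemma convolve_box N f g n : supported N f ->
  convolve op f g n = \sum_(k < N + N) op (f (k%:Z - N%:Z)) (g (n - (k%:Z - N%:Z))).
Proof.
by move=> fN; apply: intsum_box => i /fN ->; rewrite linear0l.
Qed.

Lemma supported_convolve N M f g : supported N f -> supported M g ->
  supported (N + M) (convolve op f g).
Proof.
move=> fN gM n nNM; rewrite (convolve_box _ _ fN) big1 // => k _.
have [kM|kM] := boolP (- M%:Z <= n - (k%:Z - N%:Z) < M%:Z); last first.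
  by rewrite gM // linear0r.
by exfalso; case: k kM => k /= kN; lia.
Qed.

(** Evaluation at u = 1 is multiplicative. *)
Lemma sum_convolve f g : finitely_supported f -> finitely_supported g ->
  \sum_(n \in [set: int]) convolve op f g n =
  op (\sum_(n \in [set: int]) f n) (\sum_(n \in [set: int]) g n).
Proof.
move=> [N fN] [M gM]; rewrite (intsum_box (supported_convolve fN gM)).
under eq_bigr do rewrite (convolve_box _ _ fN).
rewrite exchange_big /= (intsum_box fN) linear_sumlz /=; apply: eq_bigr => k _.
rewrite -linear_sumr /=; congr (op _ _).
rewrite -(intsum_shift g (k%:Z - N%:Z)) (@intsum_box _ (N + M)) //.
by move=> n nNM; apply: gM; case: k => k /= kN; lia.
Qed.

(** The Leibniz rule for u d/du, evaluated at u = 1. *)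
Lemma sum_euler_convolve f g : finitely_supported f -> finitely_supported g ->
  \sum_(n \in [set: int]) euler (convolve op f g) n =
  op (\sum_(n \in [set: int]) euler f n) (\sum_(n \in [set: int]) g n) +
  op (\sum_(n \in [set: int]) f n) (\sum_(n \in [set: int]) euler g n).
Proof.
move=> [N fN] [M gM].
have eN := supported_euler fN; have eM := supported_euler gM.
rewrite -!sum_convolve; try by [exists N | exists M].
rewrite -intsumD; last 2 first.
- by exists (N + M)%N; apply: supported_convolve.
- by exists (N + M)%N; apply: supported_convolve.
apply: eq_fsbigr => n _; rewrite /euler.
rewrite (convolve_box _ _ fN) (convolve_box _ _ eN) (convolve_box _ _ fN).
rewrite -big_split /= mulrz_suml; apply: eq_bigr => k _.
rewrite /euler bilinearMzl bilinearMzr -mulrzDr.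
by congr (_ *~ _); lia.
Qed.

End Convolution.

(** * The residue form *)

Section Forms.
Variables (K : fieldType) (g : lieAlgType K).
Implicit Types (f w : int -> g) (x : g).

Lemma laurent_poly_supported f : laurent_poly g f <-> finitely_supported f.
Proof.
split=> [[[a fa] [b fb]]|[N fN]].
  exists (absz a + absz b + 1)%N => n nN.
  have [na|an] := ltP n a; first exact: fa.
  by apply: fb; lia.
by split; [exists (- N%:Z)|exists N%:Z] => n nN; apply: fN; lia.
Qed.

Lemma killing_seriesC f w : killing_series f w = killing_series w f.
Proof.
apply/funext => n; rewrite /killing_series /convolve -[RHS](intsum_refl _ n).
by apply: eq_fsbigr => i _; rewrite killingC subKr.
Qed.

Lemma form_seriesC a f w : form_series a f w = form_series a w f.
Proof. by rewrite /form_series killing_seriesC. Qed.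

(** If the product c of f and w has no positive powers of u, its residue
    against 1 / (1 - u)^2 is the sum of -m c_m over m <= 0, which is the
    derivative of c with respect to 1/u at u = 1. *)
Lemma form_series_laurent_poly f w :
  finitely_supported f -> finitely_supported w ->
  (forall n, 0 < n -> killing_series f w n = 0) ->
  form_series (taylor_inv_sqr K) f w =
  - (killing (\sum_(n \in [set: int]) euler f n) (\sum_(n \in [set: int]) w n)
     + killing (\sum_(n \in [set: int]) f n)
               (\sum_(n \in [set: int]) euler w n)).
Proof.
move=> ffin wfin kpos; rewrite -sum_euler_convolve // -[convolve _ f w]/(killing_series f w).
rewrite /form_series /residue.
have [N kN] : finitely_supported (euler (killing_series f w)).
  have [N fN] := ffin; have [M wM] := wfin.
  by exists (N + M)%N; apply: supported_euler; apply: supported_convolve.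
rewrite -[RHS](intsum_raddf (@GRing.opp K)); last by exists N.
rewrite /convolve -[LHS](intsum_refl _ (-1)).
apply: eq_fsbigr => i _; rewrite /euler.
have [i0|i0] := ltP 0 i.
  by rewrite subKr kpos // mulr0 mul0rz /= oppr0.
rewrite subKr /= -mulrNz -mulrzl; congr (_ * _).
case: i i0 => [[|i]|i] //= _.
by rewrite subn1.
Qed.

(** The series (1 - 1/u)^2 u^m x.  The square cancels the double pole of
    1 / (1 - u)^2 up to the factor u^(-2). *)
Definition sqr_monomial (m : int) x : int -> g := fun n =>
  ((n == m)%:R - (n == m - 1)%:R *+ 2 + (n == m - 2)%:R) *: x.

Lemma sqr_monomial_out m x n :
  n \notin [:: m; m - 1; m - 2] -> sqr_monomial m x n = 0.
Proof.
rewrite !inE !negb_or /sqr_monomial => /and3P[/negPf -> /negPf -> /negPf ->].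
by rewrite mul0rn subr0 addr0 scale0r.
Qed.

Lemma uniq_sqr_monomial (m : int) : uniq [:: m; m - 1; m - 2].
Proof. by rewrite /= !inE; lia. Qed.

Lemma sqr_monomialE m x : [/\ sqr_monomial m x m = x,
  sqr_monomial m x (m - 1) = - (x *+ 2) & sqr_monomial m x (m - 2) = x].
Proof.
have E01 : (m == m - 1) = false by lia.
have E02 : (m == m - 2) = false by lia.
have E12 : (m - 1 == m - 2) = false by lia.
rewrite /sqr_monomial ![m - _ == m]eq_sym [m - 2 == m - 1]eq_sym.
rewrite !eqxx E01 E02 E12 /= mul0rn !subr0 !addr0 sub0r add0r.
by rewrite !scale1r scaleNr scaler_nat.
Qed.

Lemma killing_series_sqr_monomial f m x n :
  killing_series f (sqr_monomial m x) n =
  killing (f (n - m)) x - killing (f (n - m + 1)) x *+ 2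
  + killing (f (n - m + 2)) x.
Proof.
rewrite killing_seriesC /killing_series /convolve.
rewrite (fsbigE [:: m; m - 1; m - 2]) ?uniq_sqr_monomial //; last first.
  by move=> i _ /sqr_monomial_out ->; rewrite killing0l.
have [E0 E1 E2] := sqr_monomialE m x.
rewrite !big_cons big_nil !in_setT E0 E1 E2 /= addr0 addrA.
rewrite killingNl killingMnl !(killingC x).
have -> : n - (m - 1) = n - m + 1 by lia.
by have -> : n - (m - 2) = n - m + 2 by lia.
Qed.

(** Multiplying by the coefficients i + 1 of 1 / (1 - u)^2 inverts the second
    difference, up to boundary terms. *)
Lemma sum_second_difference (s : nat -> K) M :
  \sum_(i < M) i.+1%:R * (s i.+2 - s i.+1 *+ 2 + s i) =
  s 0%N - M.+1%:R * s M + M%:R * s M.+1.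
Proof.
elim: M => [|M IH]; first by rewrite big_ord0 mul1r mul0r subrr addr0.
by rewrite big_ord_recr /= IH -[M.+2]addn2 -[M.+1]addn1 !natrD; ring.
Qed.

(** These test elements recover the individual coefficients of f. *)
Lemma form_series_sqr_monomial f m x : laurent_u g f ->
  form_series (taylor_inv_sqr K) f (sqr_monomial m x) = killing (f (1 - m)) x.
Proof.
move=> [a fa]; rewrite /form_series /residue.
pose s (k : nat) := killing (f (1 - m - k%:Z)) x.
have [M sM] : exists M, forall k, (M <= k)%N -> s k = 0.
  exists (absz (1 - m - a)%R).+1 => k Mk.
  by rewrite /s fa ?killing0l //; lia.
transitivity (\sum_(i < M) i.+1%:R * (s i.+2 - s i.+1 *+ 2 + s i)); last first.
  rewrite sum_second_difference (sM M) // (sM M.+1) // !mulr0 subr0 addr0.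
  by rewrite /s subr0.
have term i : taylor_inv_sqr K (Posz i) *
    killing_series f (sqr_monomial m x) (-1 - i%:Z) =
    i.+1%:R * (s i.+2 - s i.+1 *+ 2 + s i).
  rewrite killing_series_sqr_monomial /=.
  congr (_ * (killing (f _) x - killing (f _) x *+ 2 + killing (f _) x)); lia.
rewrite /convolve (fsbigE [seq Posz i | i <- iota 0 M]) //=.
- have -> : iota 0 M = index_iota 0 M by rewrite /index_iota subn0.
  rewrite big_mkcond /= big_map big_mkord.
  by apply: eq_bigr => k _; rewrite in_setT term.
- by rewrite map_inj_uniq ?iota_uniq // => b c [].
- move=> [i|i] _ iM; last by rewrite mul0r.
  have Mi : (M <= i)%N.
    by rewrite leqNgt; apply: contra iM => iM; rewrite map_f // mem_iota.
  rewrite term (sM i) // (sM i.+1) ?(sM i.+2) ?mul0rn ?subrr ?addr0 ?mulr0 //; lia.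
Qed.

End Forms.

(** * Orders and parabolic subalgebras as filtration conditions *)

Section Valuation.
Variable R : realType.
Implicit Types f : int -> R[i].

(** The leading exponent is found by searching downwards from an upper bound of
    the support. *)
Lemma valuationP f : laurent_uV R[i]^o f -> f <> 0 ->
  exists k, is_leading f k /\ valuation f = (k%:~R)%:E.
Proof.
move=> [N fN] f0.
have [n fn] : exists n, f n != 0.
  apply: contrapT => nex; apply: f0; apply/funext => n; apply/eqP.
  by apply: contrapT => /negP fn; apply: nex; exists n.
have ex : exists k : nat, f (N - k%:Z) != 0.
  have nN : n <= N by rewrite leNgt; apply: contra fn => /fN ->.
  by exists (absz (N - n)); rewrite (_ : N - _ = n) //; lia.
have lead : is_leading f ((ex_minn ex)%:Z - N).
  case: ex_minnP => k fk kmin; split; first by rewrite opprB.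
  move=> m mk; apply/eqP; have [Nm|mN] := ltP N (- m); first by rewrite fN.
  apply: contraT => fm; have := kmin (absz (N + m)).
  by rewrite (_ : N - _ = - m) ?fm; [move=> /(_ isT); lia|lia].
exists (xget 0 [set k | is_leading f k]); split.
  by case: xgetP => [k _ //|/(_ ((ex_minn ex)%:Z - N))].
by rewrite /valuation; case: asboolP.
Qed.

End Valuation.

Section Order.
Variables (R : realType) (g : lieAlgType R[i]) (H : {vspace g}).
Local Notation n := (\dim {:g}).
Variables (e : n.-tuple g) (b : 'I_n -> cartan_dual H) (h : subvs_of H).
Hypothesis cartanH : is_cartan H.
Hypothesis eB : basis_of fullv e.
Hypothesis be : forall i, root_space (b i) (tnth e i).

Definition weight_value (i : 'I_n) : R[i] := b i h.
Local Notation d := weight_value.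

Lemma lie_weight i : lie (vsval h) (tnth e i) = d i *: tnth e i.
Proof. exact: be. Qed.

Lemma tnth_basis_neq0 i : tnth e i != 0.
Proof.
apply/eqP => ei0; have := coord_tnth eB i i.
by rewrite ei0 linear0 eqxx => /esym/eqP; rewrite oner_eq0.
Qed.

Lemma weight_root i : b i != 0 -> is_root (b i).
Proof. by move=> bi0; split=> //; exists (tnth e i); split=> //; exact: tnth_basis_neq0. Qed.

Lemma weight0_cartan i : b i = 0 -> tnth e i \in H.
Proof. by move=> bi0; apply: (root_space0_cartan cartanH); rewrite -bi0. Qed.

Lemma lie_cartan x : x \in H -> lie (vsval h) x = 0 *: x.
Proof. by have [Hab _ _] := cartanH; rewrite scale0r => xH; apply: Hab => //; exact: subvsP. Qed.

Lemma order_of_filt f : order_of h f -> forall m : int, ad_filt e d (- m%:~R) (f m).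
Proof.
move=> [k [c [s [sS ->]]]] m; rewrite fct_sumE; apply: filt_sum => i _.
apply: filtZ; case: (sS i) => [[sT sH]|[a aroot [u [uL uval] [x xa <-]]]].
  have [m0|m0] := ltP 0 m; first by rewrite sT //; apply: (filt_subspace e d _).1.
  apply: (filt_eigen eB lie_weight (lie_cartan (sH m))).
  by rewrite /= oppr_ge0 lerz0.
have [->|um] := eqVneq (u m) 0; first by rewrite scale0r; apply: (filt_subspace e d _).1.
apply: filtZ; apply: (filt_eigen eB lie_weight (xa h)).
have [|q [qL qval]] := valuationP uL.
  by move=> u0; rewrite u0 eqxx in um.
move: uval; rewrite qval lee_fin => /le_trans; apply.
rewrite -mulrNz ler_int leNgt; apply: contra um => mq.
by rewrite -(opprK m) qL.2.
Qed.

(** The coordinates of f in the eigenbasis exhibit it as a sum of one generator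
    of the order for each basis vector. *)
Lemma filt_order_of f : laurent_uV g f ->
  (forall m : int, ad_filt e d (- m%:~R) (f m)) -> order_of h f.
Proof.
move=> [N fN] ff.
exists n, (fun=> 1), (fun i m => coord e i (f m) *: tnth e i); split; last first.
  apply/funext => m; rewrite fct_sumE {1}(sum_coord eB (f m)).
  by apply: eq_bigr => i _; rewrite scale1r.
move=> i; have [bi0|bi0] := eqVneq (b i) 0.
  left; split=> m; last by apply: rpredZ; apply: weight0_cartan.
  move=> m0; rewrite ff ?scale0r // /d bi0 lfunE /=.
  by rewrite oppr_lt0 ltr0z.
right; exists (b i); first exact: weight_root.
exists (fun m => coord e i (f m)); last by exists (tnth e i).
have cL : laurent_uV R[i]^o (fun m => coord e i (f m)).
  by exists N => m Nm; rewrite fN // linear0.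
split=> //; have [c0|c0] := pselect ((fun m => coord e i (f m)) = 0).
  by rewrite c0 /valuation; case: asboolP => // _; rewrite leey.
have [q [[qL _] ->]] := valuationP cL c0; rewrite lee_fin leNgt.
apply: contra qL => qd; rewrite ff // mulrNz opprK //.
Qed.

End Order.

Section Roots.
Variables (R : realType) (g : lieAlgType R[i]) (H : {vspace g}) (l : nat).
Variables (G : l.-tuple (cartan_dual H)) (amax : cartan_dual H) (j : 'I_l).
Variable hj : subvs_of H.
Hypothesis simpleG : is_simple_roots G.
Hypothesis vertexj : is_vertex G amax j hj.

Lemma vertex_value (a : cartan_dual H) :
  (a hj : R[i]) = root_coef G j a / root_coef G j amax.
Proof.
have [_ GB _] := simpleG; have [_ Gh] := vertexj.
rewrite {1}(coord_basis GB (memvf a)) sum_lfunE (bigD1 j) //= big1 ?addr0.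
  by rewrite scale_lfunE -tnth_nth Gh eqxx mul1r.
by move=> i /negPf ij; rewrite scale_lfunE -tnth_nth Gh ij mul0r scaler0.
Qed.

Lemma root_coef_sum (m : 'I_l -> nat) i :
  root_coef G i (\sum_k tnth G k *+ m k) = (m i)%:R.
Proof.
have [_ GB _] := simpleG; rewrite /root_coef.
under eq_bigr do rewrite -scaler_nat (tnth_nth 0).
by rewrite coord_sum_free // (basis_free GB).
Qed.

Section Minuscule.
Local Notation n := (\dim {:g}).
Variables (e : n.-tuple g) (b : 'I_n -> cartan_dual H).
Hypothesis cartanH : is_cartan H.
Hypothesis maxG : is_maximal_root G amax.
Hypothesis eB : basis_of fullv e.
Hypothesis be : forall i, root_space (b i) (tnth e i).
Hypothesis Knd : killing_nondeg g.
Hypothesis k1 : root_coef G j amax = 1.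

Local Notation d := (weight_value b hj).
Let he := lie_weight hj be.

Lemma minuscule_value (a : cartan_dual H) : (a hj : R[i]) = root_coef G j a.
Proof. by rewrite vertex_value k1 divr1. Qed.

Let weightE i : exists m : nat, d i = 1 - m%:R.
Proof.
rewrite /weight_value; have [bi0|bi0] := eqVneq (b i) 0.
  by exists 1%N; rewrite bi0 lfunE /= subrr.
have [m mE] := maxG.2 _ (weight_root eB be bi0).
exists (m j); rewrite minuscule_value -root_coef_sum -k1 mE.
by rewrite /root_coef linearD /= addrK.
Qed.

(** A weight is 1 - m because the maximal root exceeds every root by a
    nonnegative combination of simple roots.  For m > 2 the sum of the weight
    with any weight is negative, so the eigenvector would lie in the
    kernel of the Killing form. *)
Lemma minuscule_weights i : [\/ d i = -1, d i = 0 | d i = 1].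
Proof.
have [m mE] := weightE i.
case: m mE => [|[|[|m]]] mE.
- by constructor 3; rewrite mE subr0.
- by constructor 2; rewrite mE subrr.
- by constructor 1; rewrite mE; ring.
exfalso; have /eqP := tnth_basis_neq0 eB i; apply; apply: Knd => y.
rewrite (sum_coord eB y) killing_sumr big1 // => k _.
rewrite killingZr (killing_eigen (he i) (he k)) ?mulr0 //.
have [m' ->] := weightE k; rewrite mE.
have -> : 1 - m.+3%:R + (1 - m'%:R) = - ((m + m').+1%:R) :> R[i].
  by rewrite -[m.+3]addn3 -[(m + m').+1]addn1 !natrD; ring.
by rewrite oppr_eq0 pnatr_eq0.
Qed.

(** The degree of a root vector is the coefficient of its root at the simple
    root, and the coefficients of a root all have the same sign. *)
Lemma parabolic_filt : parabolic G j = ad_filt e d 0.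
Proof.
apply/seteqP; split=> [_ [k [c [s [sS ->]]]]|x fx].
  apply: filt_sum => i _; apply: filtZ.
  case: (sS i) => [[sH|[a [_ aneg] sa]]|[a [_ /negP/negPn/eqP aj0] sa]].
  - exact: (filt_eigen eB he (lie_cartan hj cartanH sH)).
  - apply: (filt_eigen eB he (sa hj)); rewrite minuscule_value.
    by have := aneg j; rewrite lecE => /andP[].
  - apply: (filt_eigen eB he (sa hj)); rewrite minuscule_value.
    by rewrite aj0.
exists n, (fun i => coord e i x).
exists (fun i => if complex.Re (d i) <= 0 then tnth e i else 0); split; last first.
  rewrite {1}(filt_expand eB fx) big_mkcond; apply: eq_bigr => i _.
  by case: ifP; rewrite ?scaler0.
move=> i; case: ifP => di; last by left; left; rewrite /= mem0v.
have [bi0|bi0] := eqVneq (b i) 0.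
  by left; left; apply: (weight0_cartan cartanH be).
have biroot := weight_root eB be bi0.
have [_ _ /(_ _ biroot)[m [mE|mE]]] := simpleG.
  right; exists (b i) => //; split.
    by split=> // k; rewrite mE root_coef_sum ler0n.
  apply/negP; rewrite negbK -minuscule_value.
  have dm : d i = (m j)%:R by rewrite /weight_value minuscule_value mE root_coef_sum.
  case: (minuscule_weights i) => di1.
  - have : (0 : R[i]) <= d i by rewrite dm ler0n.
    by rewrite di1 oppr_ge0 ler10.
  - by apply/eqP.
  - by move: di; rewrite di1 /= ler10.
left; right; exists (b i) => //; split=> // k.
by rewrite mE /root_coef linearN /= -/(root_coef _ _ _) root_coef_sum oppr_le0 ler0n.
Qed.

(** The filtration is self-dual: the degrees are integers, so what is orthogonal
    to F_0 pairs to zero with everything of degree less than 1. *)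
Lemma orth_parabolic_filt :
  orth setT (@killing _ g) (parabolic G j) = ad_filt e d (-1).
Proof.
apply/seteqP; split=> [x [_ xP]|x fx]; last first.
  split=> // y; rewrite parabolic_filt => fy.
  by apply: (filt_killing eB he fx fy); lra.
apply: (filt_orth eB he Knd) => i di; apply: xP; rewrite parabolic_filt.
apply: (filt_tnth eB he); case: (minuscule_weights i) di => -> //=; lra.
Qed.

End Minuscule.
End Roots.

(** * Evaluation at u = 1 *)

Section Correspondence.
Variables (R : realType) (g : lieAlgType R[i]).
Local Notation n := (\dim {:g}).
Variables (e : n.-tuple g) (h : g) (d : 'I_n -> R[i]).
Hypothesis eB : basis_of fullv e.
Hypothesis he : forall i, lie h (tnth e i) = d i *: tnth e i.
Hypothesis d3 : forall i, [\/ d i = -1, d i = 0 | d i = 1].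
Implicit Types (f w : int -> g) (W : set (int -> g)) (L : set (g * g)).

(** The Laurent polynomials of the order attached to h, see [order_of_filt] and
    [filt_order_of]. *)
Definition polynomial_order : set (int -> g) :=
  [set f | laurent_poly g f /\ forall m : int, ad_filt e d (- m%:~R) (f m)].

(** For f in [polynomial_order], Ad(u^h) f is a polynomial in t = 1/u; this is
    its 1-jet at t = 1.  A component of degree c moves from u^m to u^(m + c), so
    the derivative with respect to t is minus the sum of (m + T) f_m. *)
Definition eval_eps f : g * g :=
  let s := \sum_(m \in [set: int]) f m in
  (s, - (\sum_(m \in [set: int]) euler f m + lie h s)).

Local Notation A := polynomial_order.
Local Notation theta := eval_eps.
Local Notation Q := (form_series (taylor_inv_sqr R[i])).

Lemma polynomial_order_supported f : A f -> finitely_supported f.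
Proof. by case=> /laurent_poly_supported. Qed.

Lemma laurent_subspace (f w : int -> g) c :
  laurent_u g f -> laurent_u g w -> laurent_u g (c *: f + w).
Proof.
move=> [a fa] [b wb]; exists (Order.min a b) => m; rewrite lt_min => /andP[ma mb].
by rewrite /= -[LHS]/(c *: f m + w m) fa // wb // scaler0 addr0.
Qed.

Lemma laurentV_subspace (f w : int -> g) c :
  laurent_uV g f -> laurent_uV g w -> laurent_uV g (c *: f + w).
Proof.
move=> [a fa] [b wb]; exists (Order.max a b) => m; rewrite gt_max => /andP[ma mb].
by rewrite /= -[LHS]/(c *: f m + w m) fa // wb // scaler0 addr0.
Qed.

Lemma polynomial_order_subspace : is_subspace A.
Proof.
split=> [|c f w [[fu fv] fF] [[wu wv] wF]].
  by split=> [|m]; [split; exists 0|apply: (filt_subspace e d _).1].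
split=> [|m]; last by apply: (filt_subspace e d _).2.
by split; [apply: laurent_subspace|apply: laurentV_subspace].
Qed.

Lemma eval_eps_linear c f w :
  A f -> A w -> theta (c *: f + w) = c *: theta f + theta w.
Proof.
move=> /polynomial_order_supported[N fN] /polynomial_order_supported[M wM].
have sumE (F F' : int -> g) N1 N2 : supported N1 F -> supported N2 F' ->
    \sum_(m \in [set: int]) (c *: F m + F' m) =
    c *: \sum_(m \in [set: int]) F m + \sum_(m \in [set: int]) F' m.
  move=> FN F'N; rewrite intsumD; [|exists N1|by exists N2].
    by rewrite (intsum_raddf (GRing.scale c)) //; exists N1.
  by move=> k /FN ->; rewrite scaler0.
have s0 : \sum_(m \in [set: int]) (c *: f + w) m =
    c *: \sum_(m \in [set: int]) f m + \sum_(m \in [set: int]) w m.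
  exact: sumE fN wM.
have s1 : \sum_(m \in [set: int]) euler (c *: f + w) m =
    c *: \sum_(m \in [set: int]) euler f m + \sum_(m \in [set: int]) euler w m.
  rewrite -(sumE _ _ _ _ (supported_euler fN) (supported_euler wM)).
  by apply: eq_fsbigr => m _; rewrite /euler -scalerMzr -mulrzDl.
rewrite /theta s0 s1 lieDr lieZr; congr pair.
by rewrite /= scalerN scalerDr -opprD addrACA.
Qed.

Lemma polynomial_order_lie f w : A f -> A w -> A (lie_series f w).
Proof.
move=> Af Aw; split=> [|m].
  apply/laurent_poly_supported.
  have [N fN] := polynomial_order_supported Af; have [M wM] := polynomial_order_supported Aw.
  by exists (N + M)%N; apply: supported_convolve.
have [N fN] := polynomial_order_supported Af.
rewrite /lie_series (convolve_box _ _ _ fN); apply: filt_sum => k _.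
have -> : - m%:~R = - (k%:Z - N%:Z)%:~R + - (m - (k%:Z - N%:Z))%:~R :> R.
  by rewrite -opprD -intrD addrC subrK.
by apply: (filt_lie eB he); [apply: Af.2|apply: Aw.2].
Qed.

Lemma eval_eps_lie f w : A f -> A w ->
  theta (lie_series f w) = lie_eps (theta f) (theta w).
Proof.
move=> /polynomial_order_supported fs /polynomial_order_supported ws.
rewrite /theta /lie_eps /lie_series /= sum_convolve // sum_euler_convolve //=.
congr pair; rewrite lieNr lieNl -opprD lieDr lieDl lie_leibniz.
by rewrite addrACA [in RHS]addrC.
Qed.

(** The product of f and w has no positive powers of u because coefficients at
    u^i and u^j with i + j > 0 are orthogonal; the terms in [lie h] cancel by
    invariance. *)
Lemma form_eval_eps f w : A f -> A w -> Q f w = form_eps (theta f) (theta w).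
Proof.
move=> Af Aw; rewrite form_series_laurent_poly; try exact: polynomial_order_supported.
  rewrite /form_eps /= killingNl killingNr -opprD killingDl killingDr.
  rewrite killing_skew.
  by congr (- _); rewrite [RHS]addrACA subrr addr0 [RHS]addrC.
move=> m m0; have [N fN] := polynomial_order_supported Af.
rewrite /killing_series (convolve_box _ _ _ fN) big1 // => k _ /=.
apply: (filt_killing eB he (Af.2 _) (Aw.2 _)).
by rewrite -opprD -intrD addrC subrK oppr_lt0 ltr0z.
Qed.

Lemma polynomial_order_neg f : laurent_u g f -> (forall m, 0 <= m -> f m = 0) -> A f.
Proof.
move=> fu f0; split=> [|m].
  by split=> //; exists 0 => m m0; apply: f0; apply: ltW.
have [m0|m0] := leP 0 m; first by rewrite f0 //; apply: (filt_subspace e d _).1.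
by apply: filt1 => //; rewrite -mulrNz ler1z; lia.
Qed.

(** The order contains all negative powers of u, so two of them suffice to
    prescribe the value and the derivative. *)
Lemma eval_eps_surj v : exists2 f, A f & theta f = v.
Proof.
(* f = x/u + y/u^2 has value x + y and derivative x + 2 y - T (x + y). *)
pose y := v.2 + lie h v.1 - v.1; pose x := v.1 - y.
pose f (m : int) : g := if m == -1 then x else if m == -2 then y else 0.
exists f.
  apply: polynomial_order_neg.
    exists (-2) => m m2; rewrite /f.
    by case: eqP => [|_]; [lia|case: eqP => //; lia].
  move=> m m0; rewrite /f.
  by case: eqP => [|_]; [lia|case: eqP => //; lia].
rewrite /theta !(@intsum_seq _ [:: -1; -2]) //.
- have xy : x + y = v.1 by rewrite subrK.
  rewrite !big_cons !big_nil /euler /f /= !addr0 xy !mulrNz mulr1z.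
  rewrite [RHS]surjective_pairing; congr pair.
  rewrite -opprD [LHS]opprD opprK -[y *~ 2]/(y *+ 2) mulr2n addrA xy.
  by rewrite /y [v.1 + _]addrC subrK addrK.
- by move=> m; rewrite !inE negb_or /euler /f => /andP[/negPf -> /negPf ->]; rewrite mul0rz.
- by move=> m; rewrite !inE negb_or /f => /andP[/negPf -> /negPf ->].
Qed.

Lemma polynomial_order_ge2 f m : A f -> 1 < m -> f m = 0.
Proof.
move=> [_ fF] m1; apply: (filt_ltN1 eB d3) (fF m).
by rewrite ltrN2 ltr1z.
Qed.

Lemma polynomial_order_at1 f : A f -> lie h (f 1) = - f 1.
Proof. by case=> _ /(_ 1) f1; apply: (filtN1_lie eB he d3). Qed.

Lemma eval_eps_taylor f : A f -> taylor_u g f ->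
  theta f = (f 0 + f 1, - lie h (f 0)).
Proof.
move=> Af ft.
have f01 m : m \notin [:: 0; 1] -> f m = 0.
  rewrite !inE negb_or => /andP[m0 m1].
  have [/ft //|m_ge0] := ltP m 0.
  by apply: polynomial_order_ge2 => //; lia.
rewrite /theta !(@intsum_seq _ [:: 0; 1]) //; last first.
  by move=> m /f01 fm; rewrite /euler fm mul0rz.
rewrite !big_cons !big_nil /euler mulr0z mulr1z !addr0 add0r.
by rewrite lieDr polynomial_order_at1 // addrCA subrr addr0.
Qed.

Lemma eval_eps_taylor_inj f : A f -> taylor_u g f -> theta f = 0 -> f = 0.
Proof.
move=> Af ft; rewrite eval_eps_taylor // => -[f01 /eqP].
rewrite oppr_eq0 => /eqP hf0.
have f1 : f 1 = 0.
  have f10 : f 0 = - f 1 by apply/eqP; rewrite -addr_eq0 f01.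
  by move: hf0; rewrite f10 lieNr polynomial_order_at1 // opprK.
have f0 : f 0 = 0 by move: f01; rewrite f1 addr0.
apply/funext => m /=; have [/ft //|m_ge0] := ltP m 0.
have [->|m0] := eqVneq m 0; first exact: f0.
have [->|m1] := eqVneq m 1; first exact: f1.
by rewrite (polynomial_order_ge2 Af) //; lia.
Qed.

(** A Taylor series of the order is f_0 + f_1 u with f_0 in F_0 and f_1 in
    F_(-1). *)
Lemma eval_eps_taylor_image :
  theta @` (A `&` taylor_u g) = ad_filt e d 0 `*` ad_filt e d (-1).
Proof.
apply/seteqP; split=> [_ [f [Af ft] <-]|[p q] [/= fp fq]].
  rewrite eval_eps_taylor //.
  have f0 : ad_filt e d 0 (f 0) by have := Af.2 0; rewrite oppr0.
  have f1 : ad_filt e d (-1) (f 1) := Af.2 1.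
  have := (filt_subspace e d 0).2 1 _ _ f0 (filt_le _ f1).
  rewrite scale1r => f01; split=> /=; first by apply: f01; lra.
  by rewrite -scaleN1r; apply: filtZ; apply: (filt0_lie eB he d3).
have fhp := filt0_lie eB he d3 fp.
(* Solves f_0 + f_1 = p and - T f_0 = q, as T f_1 = - f_1. *)
pose f1 := - (q + lie h p).
have ff1 : ad_filt e d (-1) f1.
  rewrite /f1 -scaleN1r; apply: filtZ.
  by have := (filt_subspace e d (-1)).2 1 _ _ fq fhp; rewrite scale1r.
have hf1 := filtN1_lie eB he d3 ff1.
pose f (m : int) : g := if m == 0 then p - f1 else if m == 1 then f1 else 0.
have Af : A f.
  split=> [|m].
    by split; [exists 0|exists 1] => m m0; rewrite /f;
      (case: eqP => [|_]; [lia|case: eqP => //; lia]).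
  rewrite /f; have [->|m0] := eqVneq m 0.
    rewrite oppr0.
    have /(filt_subspace e d 0).2 : ad_filt e d 0 f1 by apply: filt_le ff1; lra.
    by move=> /(_ (-1) _ fp); rewrite scaleN1r addrC.
  have [->|m1] := eqVneq m 1; first exact: ff1.
  exact: (filt_subspace e d _).1.
have ft : taylor_u g f.
  by move=> m m0; rewrite /f; case: eqP => [|_]; [lia|case: eqP => //; lia].
exists f => //; rewrite eval_eps_taylor // /f /= subrK; congr pair.
rewrite lieDr lieNr hf1 opprK /f1 opprD opprK.
by rewrite addrC addrK.
Qed.

Lemma sqr_monomial_polynomial_order m i :
  complex.Re (d i) <= - m%:~R -> A (sqr_monomial m (tnth e i)).
Proof.
move=> dm.
split=> [|k].
  split; [exists (m - 2)|exists m].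
    by move=> k mk; apply: sqr_monomial_out; rewrite !inE; lia.
  by move=> k mk; apply: sqr_monomial_out; rewrite !inE; lia.
have [mk|km] := ltP m k.
  rewrite sqr_monomial_out; first exact: (filt_subspace e d _).1.
  by rewrite !inE; lia.
apply: filtZ; apply: (filt_tnth eB he); apply: le_trans dm _.
by rewrite lerN2 ler_int.
Qed.

Lemma eval_eps_sqr_monomial m x : theta (sqr_monomial m x) = 0.
Proof.
have un := uniq_sqr_monomial m.
have w0 := @sqr_monomial_out _ _ m x.
have [E0 E1 E2] := sqr_monomialE m x.
have s0 : \sum_(k \in [set: int]) sqr_monomial m x k = 0.
  rewrite (intsum_seq un w0) !big_cons big_nil E0 E1 E2 mulr2n opprD addr0.
  by rewrite addrA addrA subrr sub0r addNr.
have s1 : \sum_(k \in [set: int]) euler (sqr_monomial m x) k = 0.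
  rewrite (intsum_seq un) => [|k /w0 wk]; last by rewrite /euler wk mul0rz.
  rewrite !big_cons big_nil /euler E0 E1 E2 addr0.
  have -> : - (x *+ 2) *~ (m - 1) = - (x *~ (2 * (m - 1))).
    by rewrite mulNrz [x *+ 2]pmulrn -mulrzA.
  rewrite -mulrNz -!mulrzDr (_ : m + _ = 0) ?mulr0z //; lia.
by rewrite /theta s0 s1 lie0r addr0 oppr0.
Qed.

Hypothesis Knd : killing_nondeg g.

(** Pairing f with the elements (1 - 1/u)^2 u^(1 - m) e_i of the kernel shows
    that f_m is orthogonal to all e_i of degree less than m; by duality f_m lies
    in F_(-m). *)
Lemma orth_ker_eval_eps f : laurent_u g f ->
  (forall w, A w -> theta w = 0 -> Q f w = 0) -> A f.
Proof.
move=> fu fQ.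
have fF m : ad_filt e d (- m%:~R) (f m).
  apply: (filt_orth eB he Knd) => i; rewrite opprK => dm.
  rewrite -[m](subKr 1) -(form_series_sqr_monomial (1 - m)) //.
  apply: fQ (eval_eps_sqr_monomial _ _).
  apply: sqr_monomial_polynomial_order; rewrite -mulrNz opprB.
  (* The degree of e_i is an integer, so less than m means at most m - 1. *)
  have: exists c : int, complex.Re (d i) = c%:~R.
    by case: (d3 i) => ->; [exists (-1)|exists 0|exists 1].
  by move=> [c cE]; move: dm; rewrite cE ltr_int ler_int; lia.
split=> //; split=> //; exists 1 => m m1.
by apply: (filt_ltN1 eB d3) (fF m); rewrite ltrN2 ltr1z.
Qed.

Definition series_lagrangians : set (set (int -> g)) :=
  [set W | [/\ lagrangian (laurent_u g) (@lie_series _ g) Q W,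
      are_transversal (laurent_u g) W (taylor_u g) & W `<=` A]].

Definition eps_lagrangians : set (set (g * g)) :=
  [set L | lagrangian setT (@lie_eps _ g) (@form_eps _ g) L /\
     are_transversal setT L (ad_filt e d 0 `*` ad_filt e d (-1))].

(** The form on A factors through [eval_eps], and W is its own orthogonal. *)
Lemma lagrangian_saturated W f :
  series_lagrangians W -> A f -> (theta @` W) (theta f) -> W f.
Proof.
move=> [[_ WE] _ WA] Af [w0 Ww0 fw0]; rewrite WE; split; first exact: Af.1.1.
move=> w Ww; rewrite form_eval_eps //; last exact: WA.
rewrite -fw0 -form_eval_eps; try exact: WA.
by move: Ww0; rewrite {1}WE => -[_]; apply.
Qed.

Lemma subspaceB (V : lmodType R[i]) (S : set V) (x y : V) :
  is_subspace S -> S x -> S y -> S (x - y).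
Proof.
by move=> [_ Slin] Sx Sy; rewrite addrC -scaleN1r; apply: Slin.
Qed.

Lemma eval_epsB f w : A f -> A w -> theta (f - w) = theta f - theta w.
Proof.
by move=> Af Aw; rewrite addrC -scaleN1r eval_eps_linear // scaleN1r addrC.
Qed.

Lemma eval_eps0 : theta 0 = 0.
Proof.
have A0 := polynomial_order_subspace.1.
by rewrite -[X in theta X](subrr 0) eval_epsB // subrr.
Qed.

(** Transversality transfers because a decomposition f = w + s with f and w in A
    has s in A, and because W contains the kernel of [eval_eps]. *)
Lemma series_to_eps W : series_lagrangians W -> eps_lagrangians (theta @` W).
Proof.
move=> SW; have [[[Wsub Wlie] WE] [Wcap Wsum] WA] := SW.
have sat f : A f -> (theta @` W) (theta f) -> W f := lagrangian_saturated SW.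
split; [split; [split; [split|]|]|split].
- by exists 0; [exact: Wsub.1|exact: eval_eps0].
- move=> c _ _ [f Wf <-] [w Ww <-]; exists (c *: f + w); first exact: Wsub.2.
  by apply: eval_eps_linear; apply: WA.
- move=> _ _ [f Wf <-] [w Ww <-]; exists (lie_series f w); first exact: Wlie.
  by apply: eval_eps_lie; apply: WA.
- apply/seteqP; split=> [_ [f Wf <-]|v [_ vL]].
    split=> // _ [w Ww <-]; rewrite -form_eval_eps; try exact: WA.
    by move: Wf; rewrite {1}WE => -[_]; apply.
  have [f Af fv] := eval_eps_surj v; exists f => //.
  rewrite WE; split=> [|w Ww]; first exact: Af.1.1.
  by rewrite form_eval_eps // ?fv; [apply: vL; exists w|apply: WA].
- apply/seteqP; split=> [v []|_ ->]; last first.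
    split; first by exists 0; [exact: Wsub.1|exact: eval_eps0].
    by split; apply: (filt_subspace e d _).1.
  rewrite -eval_eps_taylor_image => Lv [f [Af ft] fv].
  have : (W `&` taylor_u g) f by split=> //; apply: sat; rewrite ?fv.
  by rewrite Wcap => f0; rewrite /= -fv f0 eval_eps0.
- apply/seteqP; split=> // v _; have [f Af <-] := eval_eps_surj v.
  have : laurent_u g f := Af.1.1.
  rewrite Wsum => -[w Ww [s ts] fE].
  exists (theta w); first by exists w.
  have sE : s = f - w by rewrite -fE addrC addKr.
  have As : A s by rewrite sE; apply: (subspaceB polynomial_order_subspace) => //; exact: WA.
  have Aw : A w := WA _ Ww.
  exists (theta s); last by rewrite sE (eval_epsB Af Aw) [LHS]addrC subrK.
  by rewrite -eval_eps_taylor_image; exists s.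
Qed.

(** For the decomposition of a Laurent series, its part with negative exponents
    lies in A and is decomposed through [eval_eps]. *)
Lemma eps_to_series L : eps_lagrangians L ->
  series_lagrangians [set f | A f /\ L (theta f)].
Proof.
move=> [[[Lsub Llie] LE] [Lcap Lsum]].
split; [split; [split; [split|]|]|split|].
- by split; [exact: polynomial_order_subspace.1|rewrite eval_eps0; exact: Lsub.1].
- move=> c f w [Af Lf] [Aw Lw]; split; first exact: polynomial_order_subspace.2.
  by rewrite eval_eps_linear //; apply: Lsub.2.
- move=> f w [Af Lf] [Aw Lw]; split; first exact: polynomial_order_lie.
  by rewrite eval_eps_lie //; apply: Llie.
- apply/seteqP; split=> [f [Af Lf]|f [fu fQ]].
    split; first exact: Af.1.1.
    move=> w [Aw Lw]; rewrite form_eval_eps //.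
    by move: Lf; rewrite {1}LE => -[_]; apply.
  have Af : A f.
    apply: orth_ker_eval_eps => // w Aw w0; apply: fQ; split=> //.
    by rewrite w0; exact: Lsub.1.
  split=> //; rewrite LE; split=> // v Lv.
  have [w Aw wv] := eval_eps_surj v.
  by rewrite -wv -form_eval_eps //; apply: fQ; split=> //; rewrite wv.
- apply/seteqP; split=> [f [[Af Lf] ft]|_ ->]; last first.
    by split=> //; split; [exact: polynomial_order_subspace.1|rewrite eval_eps0; exact: Lsub.1].
  apply: eval_eps_taylor_inj => //.
  suff : (L `&` (ad_filt e d 0 `*` ad_filt e d (-1))) (theta f) by rewrite Lcap.
  by split=> //; rewrite -eval_eps_taylor_image; exists f.
- apply/seteqP; split=> [f [N fN]|_ [w [Aw _] [s ts] <-]]; last first.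
    rewrite -[w]scale1r; apply: laurent_subspace; first exact: Aw.1.1.
    by exists 0.
  pose fneg (m : int) : g := if m < 0 then f m else 0.
  have Aneg : A fneg.
    apply: polynomial_order_neg; first by exists N => m /fN fm; rewrite /fneg fm if_same.
    by move=> m m0; rewrite /fneg ltNge m0.
  have : [set: g * g] (theta fneg) by [].
  rewrite Lsum -eval_eps_taylor_image => -[v Lv [_ [s [As ts] <-]] vs].
  exists (fneg - s).
    split; first exact: (subspaceB polynomial_order_subspace).
    by rewrite eval_epsB // -vs addrK.
  exists (f - fneg + s); last first.
    by rewrite [LHS]addrC -addrA [s + _]addrC !subrK.
  move=> m m0; rewrite -[LHS]/(f m - fneg m + s m) /fneg m0 subrr add0r.
  exact: ts.
- by move=> f [].
Qed.

Lemma series_eps_bij :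
  set_bij series_lagrangians eps_lagrangians (fun W => theta @` W).
Proof.
split=> [W|W1 W2|L LL]; first exact: series_to_eps.
  rewrite !inE => S1 S2 E.
  have [_ _ W1A] := S1; have [_ _ W2A] := S2.
  apply/seteqP; split=> f Wf.
    by apply: (lagrangian_saturated S2); [exact: W1A|rewrite -E; exists f].
  by apply: (lagrangian_saturated S1); [exact: W2A|rewrite E; exists f].
exists [set f | A f /\ L (theta f)]; first exact: eps_to_series.
apply/seteqP; split=> [_ [f [_ Lf] <-] //|v Lv].
by have [f Af fv] := eval_eps_surj v; exists f => //; split; rewrite ?fv.
Qed.

End Correspondence.

(** * The theorem *)

(** With a zero Killing form the orthogonal of any subspace is everything, which
    leaves no room for a nonzero complement. *)
Section Degenerate.
Variables (R : realType) (g : lieAlgType R[i]).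
Hypothesis K0 : forall x y : g, killing x y = 0.

Lemma no_series_lagrangian a W x : x != 0 :> g ->
  lagrangian (laurent_u g) (@lie_series _ g) (form_series a) W ->
  ~ are_transversal (laurent_u g) W (taylor_u g).
Proof.
move=> /eqP x0 [_ WE] [Wcap _]; apply: x0.
pose f (m : int) : g := if m == 0 then x else 0.
have f0 m : m < 0 -> f m = 0 by move=> m0; rewrite /f lt_eqF.
have : (W `&` taylor_u g) f.
  split; last exact: f0.
  rewrite WE; split; first by exists 0.
  move=> w _; rewrite /form_series /residue; apply: fsbig1 => i _.
  by rewrite /killing_series /convolve fsbig1 ?mulr0 // => m _; rewrite K0.
by rewrite Wcap => /(congr1 (fun F => F 0)).
Qed.

Lemma no_eps_lagrangian (P P' : set g) L x : P x -> P' 0 -> x != 0 ->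
  lagrangian setT (@lie_eps _ g) (@form_eps _ g) L ->
  ~ are_transversal setT L (P `*` P').
Proof.
move=> Px P0 /eqP x0 [_ LE] [Lcap _]; apply: x0.
have : (L `&` (P `*` P')) (x, 0).
  by split=> //; rewrite LE; split=> // y _; rewrite /form_eps !K0 addr0.
by rewrite Lcap => -[].
Qed.

End Degenerate.

Theorem theorem2p6 (R : realType) (g : lieAlgType R[i]) (H : {vspace g})
    (l : nat) (G : l.-tuple (cartan_dual H)) (amax : cartan_dual H) (j : 'I_l)
    (hj : subvs_of H) :
  is_simple g ->
  is_cartan H ->
  is_simple_roots G ->
  is_maximal_root G amax ->
  is_vertex G amax j hj ->
  let k := root_coef G j amax in
  let LagSeries := [set W : set (int -> g) |
    [/\ lagrangian (laurent_u g) (@lie_series _ g)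
          (form_series (taylor_inv_sqr R[i])) W,
        are_transversal (laurent_u g) W (taylor_u g)
      & W `<=` order_of hj `&` laurent_poly g]] in
  let LagEps := [set L : set (g * g) |
    lagrangian setT (@lie_eps _ g) (@form_eps _ g) L /\
    are_transversal setT L (parabolic_eps G j)] in
  (k = 1 -> exists F : set (int -> g) -> set (g * g),
     set_bij LagSeries LagEps F) /\
  (1 < k -> forall W : set (int -> g), ~ LagSeries W).
Proof.
move=> simple_g cartanH simpleG maxG vertexj k LagSeries LagEps.
have [e [eB eE]] := cartan_eigenbasis cartanH.
have [b be] := choice eE.
have he := lie_weight hj be.
split=> [k1|k1 W [Wlag Wtr WO]].
  exists (fun W => eval_eps (vsval hj) @` W).
  have [Knd|K0] := simple_killing simple_g.
    have d3 := minuscule_weights simpleG vertexj maxG eB be Knd k1.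
    have -> : LagSeries = series_lagrangians e (weight_value b hj).
      rewrite /LagSeries /series_lagrangians.
      suff -> : order_of hj `&` laurent_poly g = polynomial_order e (weight_value b hj) by [].
      apply/seteqP; split=> f [].
        by move=> fO fL; split=> // m; apply: (order_of_filt cartanH eB be).
      by move=> fL fF; split=> //; apply: (filt_order_of cartanH eB be fL.2).
    have -> : LagEps = eps_lagrangians e (weight_value b hj).
      rewrite /LagEps /eps_lagrangians /parabolic_eps.
      rewrite (orth_parabolic_filt simpleG vertexj cartanH maxG eB be Knd k1).
      by rewrite (parabolic_filt simpleG vertexj cartanH maxG eB be Knd k1).
    exact: (series_eps_bij eB he d3 Knd).
  have [_ [x [xG x0]]] : is_root (tnth G j) by case: simpleG.
  have hj0 : vsval hj != 0.
    apply/eqP => hj0; move: (xG hj); rewrite hj0 lie0l.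
    move=> /esym/eqP; rewrite scaler_eq0 (negPf x0) orbF.
    by have [_ ->] := vertexj; rewrite eqxx -/k k1 divr1 oner_eq0.
  split=> [W [lagW trW _]|W1 W2|L [lagL trL]].
  - by case: (no_series_lagrangian K0 x0 lagW).
  - by rewrite inE => -[lagW trW _]; case: (no_series_lagrangian K0 x0 lagW).
  - case: (no_eps_lagrangian K0 _ _ hj0 lagL trL).
      exists 1%N, (fun=> 1), (fun=> vsval hj); split; last first.
        by rewrite big_ord1 scale1r.
      by move=> i; left; left; exact: subvsP.
    by split=> // y _; rewrite killing0l.
have [_ [x [xG x0]]] : is_root (tnth G j) by case: simpleG.
have [kR kR_gt1 kE] : exists2 r : R, 1 < r & k = r%:C.
  by move: k1; case: k => r s; rewrite ltcE /= => /andP[/eqP -> r1]; exists r.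
have hx : lie (vsval hj) x = (kR^-1)%:C *: x.
  by have [_ hG] := vertexj; rewrite (xG hj) hG eqxx -/k kE mul1r fmorphV.
have kR0 : 0 < kR^-1 by rewrite invr_gt0; lra.
have kR1 : kR^-1 < 1 by rewrite invf_lt1; lra.
have [Wsub WE] := Wlag.
(* The obstruction: its constant coefficient x has degree 1/k > 0. *)
have Wf : W (sqr_monomial 0 x).
  rewrite WE; split.
    by exists (- 2) => m m2; apply: sqr_monomial_out; rewrite !inE; lia.
  move=> w Ww; rewrite form_seriesC form_series_sqr_monomial; last first.
    by have [_ []] := WO _ Ww.
  have [/(order_of_filt cartanH eB be)/(_ 1) w1 _] := WO _ Ww.
  have fx : ad_filt e (weight_value b hj) kR^-1 x by apply: (filt_eigen eB he hx).
  by apply: (filt_killing eB he w1 fx); rewrite addrC subr_lt0.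
have [/(order_of_filt cartanH eB be)/(_ 0) + _] := WO _ Wf.
have [-> _ _] := sqr_monomialE 0 x; rewrite oppr0 => fx.
by move: x0; rewrite (filt_eigen_eq0 eB he hx kR0 fx) eqxx.
Qed.
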